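(* Let $a,b\geq 2$ be integers. For every $k\in\mathbb{Z}\setminus\{0\}$, let $e_k(x)=e^{2k\pi i x}$ $(x\in\mathbb{T})$ and let $J_{e_k}$ be the set of $x\in\mathbb{T}$ such that the Birkhoff average $$\frac{1}{N^2}\sum_{m,n=0}^{N-1}e_k(T_a^mT_b^nx)\quad (N\in\mathbb{N})$$ does not converge as $N\to\infty$. Then $$\dim_H J_{e_k}=1,$$ where $\dim_H$ denotes Hausdorff dimension.
   Context: $\mathbb{N}$ is the set of positive integers and $\mathbb{T}=\mathbb{R}/\mathbb{Z}$ with its standard metric. For an integer $c\ge 2$, $T_c:\mathbb{T}\to\mathbb{T}$ is $T_c(x)=cx$. *)

(* Defs.v *)
From HB Require Import structures.
From mathcomp Require Import all_boot all_order all_algebra.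
From mathcomp Require Import generic_quotient ring_quotient.
From mathcomp Require Import complex.
From mathcomp Require Import zify ring.
From mathcomp Require Import all_classical all_reals all_analysis.

Set Implicit Arguments.
Unset Strict Implicit.
Unset Printing Implicit Defensive.

Import Order.TTheory GRing.Theory Num.Theory.
Import numFieldNormedType.Exports.

Local Open Scope classical_set_scope.
Local Open Scope ring_scope.
Local Open Scope complex_scope.
Local Open Scope quotient_scope.

(* R/Z, as the quotient of the additive group R by the subgroup of integers. *)
Definition torus (R : realType) : Type :=
  Quotient.quot (GRing.ZmodClosed.clone R (@Num.int_num_subdef R) _).

HB.instance Definition _ (R : realType) := GRing.Zmodule.on (torus R).
HB.instance Definition _ (R : realType) := Quotient.on (torus R).

Section torus_metric.
Context {R : realType}.
Implicit Types (x y z : torus R) (s t : R).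

Lemma torus_pi_eq s t :
  (\pi_(torus R) s = \pi_(torus R) t) <-> (s - t \is a Num.int).
Proof.
have := Quotient.idealrBE (GRing.ZmodClosed.clone R (@Num.int_num_subdef R) _) s t.
by rewrite /in_mem/= => E; rewrite /in_mem/= E; split=> [/eqP|/eqP].
Qed.

Lemma torus_piD s t :
  \pi_(torus R) (s + t) = \pi_(torus R) s + \pi_(torus R) t.
Proof. exact: (Quotient.pi_add _ s t). Qed.

Lemma torus_piN s : \pi_(torus R) (- s) = - \pi_(torus R) s.
Proof. exact: (Quotient.pi_opp _ s). Qed.

Lemma torus_pi0 : \pi_(torus R) 0 = 0.
Proof. by rewrite -[0 in LHS](subrr 0) torus_piD torus_piN subrr. Qed.

Let reps x : set R := [set `|t| | t in [set t | \pi_(torus R) t = x]].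

(* The quotient metric min_n |s - t + n|; the infimum is over all real
   representatives of x - y. *)
Definition torus_dist x y : R :=
  inf [set `|t| | t in [set t | \pi_(torus R) t = x - y]].

Let reps_lb x : lbound (reps x) 0.
Proof. by move=> _ [t _ <-]. Qed.

Let reps_has_inf x : has_inf (reps x).
Proof.
split; last by exists 0; exact: reps_lb.
by exists `|repr x|, (repr x) => //=; rewrite reprK.
Qed.

Lemma torus_distxx x : torus_dist x x = 0.
Proof.
apply/eqP; rewrite eq_le; apply/andP; split.
  apply: ge_inf; first by exists 0; exact: reps_lb.
  by exists 0; rewrite ?normr0//= subrr torus_pi0.
by apply: lb_le_inf; [exact: (reps_has_inf _).1|exact: reps_lb].
Qed.

Lemma torus_dist_eq0 x y : torus_dist x y = 0 -> x = y.
Proof.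
move=> d0; have near_rep e : 0 < e ->
    exists2 t, \pi_(torus R) t = x - y & `|t| < e.
  move=> e0; have [_ [t tE <-]] := inf_adherent e0 (reps_has_inf (x - y)).
  by rewrite -/(torus_dist x y) d0 add0r => te; exists t.
have [|t tE t2] := near_rep 2^-1; first by rewrite invr_gt0.
have [t0|tN0] := eqVneq t 0.
  by apply/eqP; rewrite -subr_eq0 -tE t0 torus_pi0.
have [|s sE st] := near_rep (Num.min 2^-1 `|t|).
  by rewrite lt_min invr_gt0 ltr0n normr_gt0 tN0.
move: st; rewrite lt_min => /andP[s2 st].
have /torus_pi_eq/intrP[n nE] : \pi_(torus R) t = \pi_(torus R) s.
  by rewrite tE sE.
have n1 : `|n%:~R : R| < 1.
  rewrite -nE (le_lt_trans (ler_normB _ _))//.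
  by rewrite [ltRHS](splitr 1) mul1r ltrD.
have n0 : n = 0.
  apply/eqP; rewrite -normr_eq0; move: n1.
  by rewrite -intr_norm -[ltRHS](mulr1z (1 : R)) ltr_int; lia.
by move: nE st; rewrite n0 => /eqP; rewrite subr_eq0 => /eqP ->; rewrite ltxx.
Qed.

Lemma torus_distC x y : torus_dist x y = torus_dist y x.
Proof.
rewrite /torus_dist; congr inf; apply/seteqP; split=> _ [t tE <-] /=;
  by exists (- t); rewrite ?normrN//= torus_piN tE opprB.
Qed.

Lemma torus_dist_triangle y x z :
  torus_dist x z <= torus_dist x y + torus_dist y z.
Proof.
apply/ler_addgt0Pl => e e0.
have e20 : 0 < e / 2 by rewrite divr_gt0.
have [_ [t tE <-] te] := inf_adherent e20 (reps_has_inf (x - y)).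
have [_ [s sE <-] se] := inf_adherent e20 (reps_has_inf (y - z)).
apply: (@le_trans _ _ `|t + s|).
  apply: ge_inf; first by exists 0; exact: reps_lb.
  by exists (t + s); rewrite //= torus_piD tE sE addrA subrK.
rewrite (le_trans (ler_normD _ _))// (le_trans (ltW (ltrD te se)))//.
by rewrite addrACA -splitr addrC.
Qed.

HB.instance Definition _ := isMetric.Build R (torus R)
  torus_distxx torus_dist_eq0 torus_distC torus_dist_triangle.

End torus_metric.

Section hausdorff_dimension.
Context {R : realType} {M : metricType R}.
Implicit Types (E U : set M) (s d : R).
Local Open Scope ereal_scope.

(* The diameter of the empty set is -oo. *)
Definition diameter U : \bar R :=
  ereal_sup [set (mdist p.1 p.2)%:E | p in U `*` U].

(* The test for emptiness is only relevant for s = 0, as 0 `^ 0 = 1. *)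
Definition diameter_pow s U : \bar R :=
  if U == set0 then 0 else (diameter U) `^ s.

Definition hausdorff_premeasure s d E : \bar R :=
  ereal_inf [set \sum_(i <oo) diameter_pow s (F i) | F in
    [set F : nat -> set M |
      E `<=` \bigcup_i F i /\ forall i, diameter (F i) <= d%:E]].

Definition hausdorff_measure s E : \bar R :=
  ereal_sup [set hausdorff_premeasure s d E | d in [set d : R | (0 < d)%R]].

Definition hausdorff_dim E : \bar R :=
  ereal_inf [set s%:E | s in [set s : R | (0 <= s)%R /\
    hausdorff_measure s E = 0]].

End hausdorff_dimension.

Section times_ab.
Context {R : realType}.
Implicit Types (x : torus R) (f : torus R -> R[i]).

Definition times_map (c : int) x : torus R := x *~ c.

(* e^(i t), by Euler's formula. *)
Definition expi (t : R) : R[i] := cos t +i* sin t.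

Definition fourier_e (k : int) x : R[i] := expi (2 * k%:~R * pi * repr x).

Let periodic_int (f : R -> R) : periodic f (pi *+ 2) ->
  forall (n : int) t, f (t + n%:~R * (pi *+ 2)) = f t.
Proof.
move=> fP n t; case: n => n; first by rewrite -pmulrn mulr_natl periodicn.
rewrite NegzE mulrNz mulNr -pmulrn mulr_natl.
by rewrite -[RHS](congr1 f (subrK (pi *+ 2 *+ n.+1) t)) (periodicn fP).
Qed.

Let expiD2pi (n : int) t : expi (t + n%:~R * (pi *+ 2)) = expi t.
Proof.
by rewrite /expi (periodic_int (@cosD2pi R)) (periodic_int (@sinD2pi R)).
Qed.

(* The value does not depend on the chosen representative. *)
Lemma fourier_e_pi (k : int) (t : R) :
  fourier_e k (\pi_(torus R) t) = expi (2 * k%:~R * pi * t).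
Proof.
have /torus_pi_eq/intrP[n nE] :
    \pi_(torus R) (repr (\pi_(torus R) t)) = \pi_(torus R) t by rewrite reprK.
rewrite /fourier_e; set r := repr _ in nE *.
rewrite -[r](subrK t) nE addrC mulrDr.
have -> : 2 * k%:~R * pi * n%:~R = (k * n)%:~R * (pi *+ 2) :> R.
  by rewrite intrM -mulr_natl; ring.
by rewrite expiD2pi.
Qed.

(* The junk value at N = 0 is 0 and plays no role in convergence. *)
Definition birkhoff_avg (a b : int) f x (N : nat) : R[i] :=
  (N%:R ^+ 2)^-1 *
    \sum_(m < N) \sum_(n < N) f (iter m (times_map a) (iter n (times_map b) x)).

(* R[i]^o carries the topology of the complex modulus. *)
Definition divergence_set (a b : int) f : set (torus R) :=
  [set x | ~ cvg ((birkhoff_avg a b f x : nat -> R[i]^o) @ \oo)].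

End times_ab.

(* Main.v *)
From HB Require Import structures.
Require Import Defs.
From mathcomp Require Import all_boot all_order all_algebra.
From mathcomp Require Import generic_quotient ring_quotient.
From mathcomp Require Import complex zify ring lra.
From mathcomp Require Import all_classical all_reals all_analysis.
From mathcomp Require Import measurable_realfun.

Set Implicit Arguments.
Unset Strict Implicit.
Unset Printing Implicit Defensive.

Import Order.TTheory GRing.Theory Num.Theory.
Import numFieldNormedType.Exports.

Local Open Scope classical_set_scope.
Local Open Scope ring_scope.

(** Write q = a b. If the averages converged almost everywhere for a probability
measure mu, then, being bounded, they would have convergent mu-means. So it is
enough to find measures mu of dimension as close to 1 as desired for which the
mu-means of the averages oscillate.

The measure used is the law of [gapped t] for t uniform in [0, 1]. This map
writes the base-q digits of t after a leading zero and inserts a block of zeros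
at the positions between L_j = p (j+1)! + j! and M_j = (p+1) (j+1)!, for every j. The mean of the
N-th average is the mean over m, n < N of the Fourier coefficients of mu at
h = k a^m b^n. Let m and n be at least M_(j-1) and slightly smaller than M_j; all
the other pairs are too few to matter. Only the digits in (M_(j-1), L_j] and
those after M_j influence h x modulo 1. If q^L_j does not divide h, averaging
over the first group of digits kills the coefficient; if q^L_j divides h, then
h x is close to an integer and the coefficient has real part at least 1/2
([mean_eq0], [mean_ge_half]). When N is slightly smaller than L_j no frequency
is divisible by q^L_j, and the mean of the average is almost 0; when N is
slightly smaller than M_j all the frequencies of the square L_j <= m, n < N are,
and since this square is a proportion of about 1 / (p+1)^2 of all pairs, the
mean stays away from 0 ([mean_avg_gap], [divergence_not_negligible]). Only first
moments enter, so a and b may be multiplicatively dependent.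

As for the dimension, the zero blocks are short: [gapped] is expanding with
exponent p / (p+1), in the sense that |t - u| is at most a constant times
|gapped t - gapped u|^s for s <= p / (p+1) ([gapped_expand]). A cover of the
divergence set by sets of diameters d_i thus pulls back to a cover by intervals
of lengths O(d_i^s), and a vanishing s-dimensional measure with s < 1 would make
the set of t for which [gapped t] diverges Lebesgue null, for p large
([hausdorff_null_preimage]). The upper bound holds for every subset of the
circle, which n arcs of length 1/n cover. *)

(** * Sine and cosine in units of full turns *)

Section turns.
Context {R : realType}.
Implicit Types x y : R.

Definition cosT x : R := cos (2 * pi * x).
Definition sinT x : R := sin (2 * pi * x).

Lemma cosTD x y : cosT (x + y) = cosT x * cosT y - sinT x * sinT y.
Proof. by rewrite /cosT mulrDr cosD. Qed.

Lemma sinTD x y : sinT (x + y) = sinT x * cosT y + cosT x * sinT y.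
Proof. by rewrite /sinT mulrDr sinD. Qed.

Lemma turn_int x : x \is a Num.int -> cosT x = 1 /\ sinT x = 0.
Proof.
have turn_nat (n : nat) : cosT n%:R = 1 /\ sinT n%:R = 0.
  rewrite /cosT /sinT.
  have -> : 2 * pi * n%:R = 0 + pi *+ 2 *+ n :> R.
    by rewrite add0r mulr_natl mulr_natr.
  rewrite (periodicn (@cosD2pi R)) (periodicn (@sinD2pi R)).
  by rewrite cos0 sin0.
move=> /intrP[[n|n] ->]; first by rewrite -pmulrn; exact: turn_nat.
have [c s] := turn_nat n.+1.
rewrite NegzE mulrNz -pmulrn /cosT /sinT mulrN cosN sinN.
by rewrite -/(cosT _) -/(sinT _) c s oppr0.
Qed.

Lemma cosTDint x y : y \is a Num.int -> cosT (x + y) = cosT x.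
Proof. by move=> /turn_int[c s]; rewrite cosTD c s mulr1 mulr0 subr0. Qed.

Lemma sinTDint x y : y \is a Num.int -> sinT (x + y) = sinT x.
Proof. by move=> /turn_int[c s]; rewrite sinTD c s mulr1 mulr0 addr0. Qed.

Lemma cosT_half x : cosT x = 1 - 2 * sin (pi * x) ^+ 2.
Proof.
rewrite /cosT; have -> : 2 * pi * x = (pi * x) *+ 2 by rewrite -mulrA mulr_natl.
by rewrite cos_mulr2n -[cos _ ^+ 2](addrK (sin (pi * x) ^+ 2)) cos2Dsin2; ring.
Qed.

(** By the half-angle formula, the cosine is 1 only where the sine of half the
angle, which is positive inside the period, vanishes. *)
Lemma cosT_eq1 x : cosT x = 1 -> x \is a Num.int.
Proof.
set n : R := (Num.floor x)%:~R; have nint : n \is a Num.int by rewrite intr_int.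
have /andP[nx xn] := floor_itv x; rewrite -/n in nx.
rewrite -[x](subrK n) cosTDint// cosT_half => /eqP.
rewrite -subr_eq0 addrAC subrr add0r oppr_eq0 mulf_eq0 pnatr_eq0 expf_eq0/=.
move: nx; rewrite -subr_ge0 le_eqVlt => /predU1P[<-|nx]; first by rewrite add0r.
rewrite gt_eqF// sin_gt0_pi// mulr_gt0 ?pi_gt0//=.
by rewrite -[ltRHS]mulr1 ltr_pM2l ?pi_gt0// ltrBlDl (lt_le_trans xn)// intrD.
Qed.

Lemma cosT_ge_half x : `|x| <= 1 / 8 -> 1 / 2 <= cosT x.
Proof.
move=> x8.
have [y y0 [yx ->]] : exists2 y, 0 <= y & y <= 1 / 8 /\ cosT x = cosT y.
  exists `|x| => //; split=> //; rewrite /cosT.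
  by case: (ger0P x) => // _; rewrite mulrN cosN.
have pi_pos := @pi_gt0 R.
have : cosT (1 / 8) <= cosT y.
  rewrite /cosT leNgt ltr_cos ?in_itv/=; last 2 first.
  - by apply/andP; split; nra.
  - by apply/andP; split; nra.
  by rewrite -leNgt ler_pM2l//; lra.
apply: le_trans.
have c_ge0 : 0 <= cosT (1 / 8).
  by apply: cos_ge0_pihalf; rewrite -!mulrA; apply/andP; split; nra.
have : cosT (1 / 8 + 1 / 8) = 0.
  by rewrite /cosT (_ : 2 * pi * _ = pi / 2) ?cos_pihalf//; field.
rewrite cosTD; have : cosT (1 / 8) ^+ 2 + sinT (1 / 8) ^+ 2 = 1.
  exact: cos2Dsin2.
by move: (cosT _) (sinT _) c_ge0 => c s; nra.
Qed.

Lemma measurable_cosT (f : R -> R) :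
  measurable_fun setT f -> measurable_fun setT (fun t => cosT (f t)).
Proof.
move=> mf; apply: (@measurableT_comp _ _ _ _ _ _ cos).
  by apply: continuous_measurable_fun; exact: continuous_cos.
by apply: measurable_funM => //; exact: measurable_cst.
Qed.

Lemma measurable_sinT (f : R -> R) :
  measurable_fun setT f -> measurable_fun setT (fun t => sinT (f t)).
Proof.
move=> mf; apply: (@measurableT_comp _ _ _ _ _ _ sin).
  by apply: continuous_measurable_fun; exact: continuous_sin.
by apply: measurable_funM => //; exact: measurable_cst.
Qed.

Lemma cosT_norm_le1 x : `|cosT x| <= 1.
Proof. by rewrite ler_norml cos_geN1 cos_le1. Qed.

Lemma sinT_norm_le1 x : `|sinT x| <= 1.
Proof. by rewrite ler_norml sin_geN1 sin_le1. Qed.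

End turns.

(** * Translation invariance and integrals over one period *)

Section lebesgue_translation.
Context {R : realType}.
Local Notation mu := (@lebesgue_measure R).

Definition translation (r : R) : measurableTypeR R -> measurableTypeR R :=
  fun t => t + r.

Let measurable_translation r : measurable_fun setT (translation r).
Proof. by apply: measurable_funD => //; exact: measurable_cst. Qed.

HB.instance Definition _ r :=
  isMeasurableFun.Build _ _ _ _ (translation r) (measurable_translation r).

(** A measure that agrees with the length on intervals is the Lebesgue measure. *)
Lemma lebesgue_measure_shift (r : R) (A : set R) : measurable A ->
  pushforward mu (translation r) A = mu A.
Proof.
move=> mA; apply/esym/lebesgue_measure_unique => //= _ [[a b]] _ <-.
rewrite /pushforward/=.
have -> : translation r @^-1` `]a, b] = `]a - r, b - r]%classic.
  by apply/seteqP; split => t /=; rewrite !in_itv/= ltrBlDr lerBrDr.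
by rewrite !lebesgue_measure_itv/= !lte_fin ltrD2r -!EFinB opprB addrA subrK.
Qed.

Lemma bounded_integrable_itv (F : R -> R) (a b : R) :
  measurable_fun setT F -> (exists M, forall t, `|F t| <= M) ->
  mu.-integrable `[a, b] (EFin \o F).
Proof.
move=> mF [M FM].
have fin : (mu `[a, b] < +oo)%E.
  by rewrite lebesgue_measure_itv/=; case: ifP => _; rewrite -?EFinB ltry.
apply: measurable_bounded_integrable => //; first exact: measurable_funTS.
exists M; split; first exact: num_real.
by move=> x Mx t _ /=; rewrite (le_trans (FM t))// ltW.
Qed.

Lemma Rintegral_shift (F : R -> R) (a b r : R) :
  measurable_fun setT F -> (exists M, forall t, `|F t| <= M) ->
  \int[mu]_(t in `[a, b]) F (t + r) = \int[mu]_(t in `[a + r, b + r]) F t.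
Proof.
move=> mF bF; rewrite /Rintegral; congr fine.
have mFE : measurable_fun setT (EFin \o F) by exact/measurable_EFinP.
have preE : translation r @^-1` `[a + r, b + r] = `[a, b]%classic.
  by apply/seteqP; split => t /=; rewrite !in_itv/= !lerD2r.
transitivity
  (\int[pushforward mu (translation r)]_(y in `[(a + r)%R, (b + r)%R]) (F y)%:E)%E.
  rewrite integral_pushforward ?preE//.
  apply: bounded_integrable_itv; last by case: bF => M FM; exists M.
  by apply: (measurableT_comp mF); exact: measurable_translation.
by apply: eq_measure_integral => A mA _; exact: lebesgue_measure_shift.
Qed.

Lemma Rintegral_periodic_shift (F : R -> R) (r : R) :
  measurable_fun setT F -> (exists M, forall t, `|F t| <= M) ->
  (forall t, F (t + 1) = F t) -> 0 <= r <= 1 ->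
  \int[mu]_(t in `[0, 1]) F (t + r) = \int[mu]_(t in `[0, 1]) F t.
Proof.
move=> mF bF F1 /andP[r0 r1].
have split_at a x b : a <= x -> x <= b ->
    \int[mu]_(t in `[a, b]) F t =
    \int[mu]_(t in `[a, x]) F t + \int[mu]_(t in `[x, b]) F t.
  move=> ax xb; apply/eqP; rewrite addrC -subr_eq; apply/eqP.
  rewrite Rintegral_itvB ?bnd_simp//; last exact: bounded_integrable_itv.
  rewrite Rintegral_itv_obnd_cbnd//.
  apply: integrableS (@bounded_integrable_itv F x b mF bF) => //.
  by apply: subset_itvr; rewrite bnd_simp.
rewrite Rintegral_shift// add0r (split_at r 1 (1 + r))//; last by rewrite lerDl.
rewrite (split_at 0 r 1)// addrC; congr (_ + _).
rewrite -[X in `[X, _]]add0r [X in `[_, X]]addrC -Rintegral_shift//.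
by apply: eq_Rintegral => t _; rewrite F1.
Qed.

End lebesgue_translation.

Section rotation.
Context {R : realType}.

(** If translating by r turns the vector (f, g) by the angle x, then the vector of
the two integrals over a period is fixed by this rotation, hence zero. *)
Lemma Rintegral_rotation0 (f g : R -> R) (r x : R) :
  measurable_fun setT f -> measurable_fun setT g ->
  (exists M, forall t, `|f t| <= M) -> (exists M, forall t, `|g t| <= M) ->
  (forall t, f (t + 1) = f t) -> (forall t, g (t + 1) = g t) ->
  0 <= r <= 1 -> x \isn't a Num.int ->
  (forall t, f (t + r) = f t * cosT x - g t * sinT x) ->
  (forall t, g (t + r) = g t * cosT x + f t * sinT x) ->
  \int[lebesgue_measure]_(t in `[0, 1]) f t = 0.
Proof.
move=> mf mg bf bg f1 g1 r01 xN fr gr.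
have := Rintegral_periodic_shift mf bf f1 r01.
have := Rintegral_periodic_shift mg bg g1 r01.
under eq_Rintegral do rewrite gr.
under [in X in _ -> X]eq_Rintegral do rewrite fr.
have i_f := @bounded_integrable_itv _ _ 0 1 mf bf.
have i_g := @bounded_integrable_itv _ _ 0 1 mg bg.
have iZ (h : R -> R) y : measurable_fun setT h -> (exists M, forall t, `|h t| <= M) ->
    lebesgue_measure.-integrable `[0, 1] (EFin \o (fun t => h t * y)).
  move=> mh [M hM]; apply: bounded_integrable_itv.
    by apply: measurable_funM => //; exact: measurable_cst.
  by exists (M * `|y|) => t; rewrite normrM ler_wpM2r.
rewrite RintegralD ?RintegralB ?RintegralZr//; try exact: iZ.
have : cosT x <> 1 by move=> /cosT_eq1; rewrite (negbTE xN).
move: (\int[lebesgue_measure]_(t in `[0, 1]) f t)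
  (\int[lebesgue_measure]_(t in `[0, 1]) g t) (cosT x) (sinT x) => X Y c s c1.
move=> eY eX; apply/eqP.
have /eqP : ((1 - c) ^+ 2 + s ^+ 2) * X = 0.
  transitivity ((1 - c) * (X - (X * c - Y * s)) - s * (Y - (Y * c + X * s))).
    by ring.
  by rewrite eX eY !subrr !mulr0 subrr.
rewrite mulf_eq0 => /predU1P[|//].
by move/eqP; rewrite paddr_eq0 ?sqr_ge0// sqrf_eq0 subr_eq0 => /andP[/eqP c1' _];
  case: c1.
Qed.

End rotation.

(** * Integrals of finite sums *)

Section Rintegral_sum.
Context d {T : measurableType d} {R : realType}.
Variables (mu : {measure set T -> \bar R}) (D : set T) (n : nat).
Variable f : 'I_n -> T -> R.
Hypotheses (mD : measurable D)
  (f_int : forall i, mu.-integrable D (EFin \o f i)).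

Lemma integrable_sum_EFin :
  mu.-integrable D (EFin \o (fun x => \sum_(i < n) f i x)).
Proof.
rewrite (_ : _ \o _ = fun x => (\sum_(i < n) (EFin \o f i) x)%E).
  exact: integrable_sum.
by apply/funext => x; rewrite /= sumEFin.
Qed.

Lemma Rintegral_sum :
  \int[mu]_(x in D) \sum_(i < n) f i x = \sum_(i < n) \int[mu]_(x in D) f i x.
Proof.
rewrite {1}/Rintegral; under eq_integral do rewrite -sumEFin.
rewrite (integral_sum mD f_int) -[RHS]/(fine _%:E) -sumEFin; congr fine.
by apply: eq_bigr => i _; rewrite fineK//; exact: (integrable_fin_num mD (f_int i)).
Qed.

End Rintegral_sum.

(** * Spreading out the digits of a real number *)

Section spread.
Context {R : realType}.
Variables (Q : nat -> nat) (z : R^nat).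

Definition gfloor (i : nat) (t : R) : R :=
  (Num.floor ((Q i)%:R * t))%:~R / (Q i)%:R.

(** With Q i = q ^ I_i and z i = q ^ (- Z_i), where I_i counts the digits of t in
the blocks up to the i-th and Z_i the zeros inserted before its end, this is
the number whose blocks of digits are those of t, the zeros being inserted in
between: it is the sum of the blocks of t, each shifted to its place, after
summation by parts. In this form it is visibly nondecreasing in t. *)
Definition spread (t : R) : R :=
  limn (series (fun i => gfloor i t * (z i - z i.+1))).

Hypothesis Q_gt0 : forall i, (0 < Q i)%N.
Hypothesis Q_dvd : forall i, (Q i %| Q i.+1)%N.
Hypothesis z_anti : forall i, z i.+1 <= z i.
Hypothesis z_cvg0 : z @ \oo --> (0 : R).

Let QR_gt0 i : 0 < (Q i)%:R :> R. Proof. by rewrite ltr0n. Qed.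

Lemma gfloor_le i t : gfloor i t <= t.
Proof. by rewrite ler_pdivrMr// mulrC floor_le. Qed.

Lemma gfloor_gt i t : t - (Q i)%:R^-1 < gfloor i t.
Proof.
rewrite ltr_pdivlMr// mulrBl mulVf ?gt_eqF// ltrBlDr mulrC.
by rewrite (lt_le_trans (floorD1_gt _))// intrD.
Qed.

Lemma gfloor_homo i : {homo gfloor i : s t / s <= t}.
Proof.
by move=> s t st; rewrite ler_pM2r ?invr_gt0// ler_int le_floor// ler_pM2l.
Qed.

Let Q_dvdn i j : (i <= j)%N -> (Q i %| Q j)%N.
Proof.
by move=> /subnK <-; elim: (_ - _)%N => // n /dvdn_trans; apply; rewrite addSn.
Qed.

Lemma gfloor_small i j t : (i <= j)%N -> 0 <= t < (Q j)%:R^-1 -> gfloor i t = 0.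
Proof.
move=> ij /andP[t0 tj].
rewrite /gfloor (@floor_def _ _ 0) ?mul0r// mulr0z mulr_ge0//=.
rewrite -lter_pdivlMl// mulr1 (lt_le_trans tj)// lef_pV2 ?posrE// ler_nat.
by rewrite dvdn_leq// Q_dvdn.
Qed.

Lemma gfloor_shift i j t : (j <= i)%N ->
  gfloor i (t + (Q j)%:R^-1) = gfloor i t + (Q j)%:R^-1.
Proof.
move=> /Q_dvdn/dvdnP[m mE]; rewrite /gfloor mulrDr mE natrM mulfK ?gt_eqF//.
have mint : (m%:R : R) \is a Num.int by rewrite natr_int.
rewrite floorDrz// intrD (floorK mint) mulrDl; congr (_ + _).
rewrite invfM mulrA divff ?mul1r// pnatr_eq0.
by move: (Q_gt0 i); rewrite mE; case: (m).
Qed.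

Lemma is_cvg_spread t :
  cvgn (series (fun i => gfloor i t * (z i - z i.+1))).
Proof.
apply: normed_cvg.
have bnd i : `|gfloor i t| <= `|t| + 1.
  have Qi1 : (Q i)%:R^-1 <= 1 :> R by rewrite invf_le1// ler1n.
  have := gfloor_le i t; have := gfloor_gt i t.
  by have := ler_norm t; have := ler_norm (- t); rewrite normrN ler_norml; lra.
apply: (@series_le_cvg _ _ (fun i => (`|t| + 1) * (z i - z i.+1))).
- by move=> i; exact: normr_ge0.
- by move=> i; rewrite mulr_ge0 ?subr_ge0// addr_ge0.
- move=> i /=; rewrite normrM [X in _ * X]ger0_norm ?subr_ge0//.
  by rewrite ler_wpM2r// subr_ge0.
have -> : series (fun i => (`|t| + 1) * (z i - z i.+1)) =
    (fun n => (`|t| + 1) * (z 0%N - z n)).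
  apply/funext => n; rewrite /series/= -mulr_sumr; congr (_ * _).
  rewrite -[RHS]opprB -(telescope_sumr z (leq0n n)) -sumrN.
  by apply: eq_bigr => i _; rewrite opprB.
by apply: is_cvgMr; apply: is_cvgB; [exact: is_cvg_cst|apply/cvg_ex; exists 0].
Qed.

(** All the estimates on [spread] come from this one: the weights z i - z i.+1 of
the levels beyond j add up to z j. *)
Lemma spread_diff_ge j c s t :
  (forall i, (j <= i)%N -> c <= gfloor i t - gfloor i s) ->
  \sum_(i < j) (gfloor i t - gfloor i s) * (z i - z i.+1) + c * z j
    <= spread t - spread s.
Proof.
move=> ge_c.
pose a u i := gfloor i u * (z i - z i.+1).
have cvgst : (fun n => series (a t) n - series (a s) n) @ \oo -->
    spread t - spread s.
  by apply: cvgB; exact: is_cvg_spread.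
have cvgL : (fun n => \sum_(i < j) (gfloor i t - gfloor i s) * (z i - z i.+1) +
    c * (z j - z n)) @ \oo -->
    \sum_(i < j) (gfloor i t - gfloor i s) * (z i - z i.+1) + c * z j.
  rewrite -[X in c * X](subr0 (z j)).
  by apply: cvgD; [exact: cvg_cst|apply: cvgMr; apply: cvgB => //; exact: cvg_cst].
apply: (ler_cvg_to cvgL cvgst).
exists j => // n /= jn.
rewrite /series/= -sumrB -(subnKC jn) [leRHS](@big_cat_nat _ _ _ j)//=; last first.
  by rewrite leq_addr.
rewrite big_mkord lerD//.
  by under [leRHS]eq_bigr do rewrite -mulrBl.
rewrite subnKC// -[leLHS]opprK -mulrN opprB -(telescope_sumr z jn) mulr_sumr -sumrN.
rewrite [leLHS]big_nat_cond [leRHS]big_nat_cond.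
apply: ler_sum => i /andP[/andP[ji _] _].
by rewrite -mulrN opprB -mulrBl ler_wpM2r ?subr_ge0// ge_c.
Qed.

Lemma spread_homo : {homo spread : s t / s <= t}.
Proof.
move=> s t st; rewrite -subr_ge0.
have := @spread_diff_ge 0 0 s t; rewrite big_ord0 mul0r addr0; apply => i _.
by rewrite subr_ge0 gfloor_homo.
Qed.

(** Adding 1 / Q j to t translates all the finer truncations by the same amount,
so that, up to the first j terms, [spread] is translated by a constant. *)
Lemma spread_shift j t : spread (t + (Q j)%:R^-1) = spread t +
  \sum_(i < j) (gfloor i (t + (Q j)%:R^-1) - gfloor i t) * (z i - z i.+1) +
  (Q j)%:R^-1 * z j.
Proof.
set t' := t + _; set S := \sum_(i < j) _.
apply/eqP; rewrite eq_le; apply/andP; split; last first.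
  rewrite -addrA -lerBrDl; apply: spread_diff_ge => i ji.
  by rewrite gfloor_shift// addrC addKr.
have := @spread_diff_ge j (- (Q j)%:R^-1) t' t.
have -> : \sum_(i < j) (gfloor i t - gfloor i t') * (z i - z i.+1) = - S.
  by rewrite /S -sumrN; apply: eq_bigr => i _; rewrite -[RHS]mulNr opprB.
move=> /(_ _)/wrap[] => [i ji|].
  by rewrite gfloor_shift// opprD addrA subrr add0r.
by lra.
Qed.

Let gfloor0 i : gfloor i 0 = 0.
Proof. by apply: (@gfloor_small i i); rewrite // lexx invr_gt0 QR_gt0. Qed.

Lemma spread0 : spread 0 = 0.
Proof.
rewrite /spread (_ : (fun i => _) = fun=> 0); last first.
  by apply/funext => i; rewrite gfloor0 mul0r.
by rewrite (_ : series _ = fun=> 0) ?lim_cst//; apply/funext => n;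
  rewrite /series/= big1.
Qed.

Lemma spread_le j t : 0 <= t -> (forall i, (i < j)%N -> gfloor i t = 0) ->
  0 <= spread t <= t * z j.
Proof.
move=> t0 tj; rewrite -[X in X <= _]spread0 spread_homo//=.
have := @spread_diff_ge j (- t) t 0; rewrite big1 ?add0r => [|i _]; last first.
  by rewrite gfloor0 tj ?subrr ?mul0r.
rewrite spread0 sub0r mulNr lerN2; apply => i _.
by rewrite gfloor0 sub0r lerN2 gfloor_le.
Qed.

(** Beyond the first level with Q j >= 2 / (t - s), every truncation keeps at least
half of the difference t - s. *)
Lemma spread_gap j s t : 2 / (Q j)%:R <= t - s ->
  (t - s) / 2 * z j <= spread t - spread s.
Proof.
move=> jst.
have Qj_gt0 := QR_gt0 j.
have st : s <= t by rewrite -subr_ge0 (le_trans _ jst)// divr_ge0 ?ltW.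
apply: le_trans (@spread_diff_ge j ((t - s) / 2) s t _) => [|i ji].
  rewrite lerDr sumr_ge0// => i _.
  by rewrite mulr_ge0// subr_ge0// gfloor_homo.
have QiQj : (Q i)%:R^-1 <= (Q j)%:R^-1 :> R.
  by rewrite lef_pV2 ?posrE// ler_nat dvdn_leq// Q_dvdn.
by move: (gfloor_le i s) (gfloor_gt i t) jst; lra.
Qed.

(** A frequency h for which the digits of the first j blocks contribute integers
to h * spread t. *)
Definition resonant (h : R) (j : nat) : Prop := forall i, (i < j)%N ->
  h * (z i / (Q i)%:R) \is a Num.int /\ h * (z i.+1 / (Q i)%:R) \is a Num.int.

(** For a resonant frequency the first j terms of [spread_shift] disappear modulo 1,
and translating t by 1 / Q j turns the wave of frequency h by a fixed angle. *)
Lemma phase_shift (h : R) (j n : nat) (t : R) : resonant h j ->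
  h * spread (t + n%:R / (Q j)%:R) -
    (h * spread t + n%:R * (h * (z j / (Q j)%:R))) \is a Num.int.
Proof.
move=> res; elim: n => [|n IHn].
  by rewrite !mul0r !addr0 subrr.
set t' := t + n%:R / _ in IHn.
have -> : t + n.+1%:R / (Q j)%:R = t' + (Q j)%:R^-1.
  by rewrite /t' -natr1 mulrDl mul1r addrA.
rewrite spread_shift; set S := \sum_(i < j) _.
have Sint : h * S \is a Num.int.
  rewrite /S mulr_sumr; apply: rpred_sum => i _.
  have [zi zi1] := res i (ltn_ord i).
  rewrite /gfloor -mulrBl.
  set f1 := (Num.floor _)%:~R; set f2 := (Num.floor _)%:~R.
  have -> : h * ((f1 - f2) / (Q i)%:R * (z i - z i.+1)) =
      (f1 - f2) * (h * (z i / (Q i)%:R) - h * (z i.+1 / (Q i)%:R)) by ring.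
  by rewrite rpredM// rpredB// intr_int.
set a := h * _ in IHn; rewrite -natr1.
have -> : h * (spread t' + S + (Q j)%:R^-1 * z j) -
    (h * spread t + (n%:R + 1) * (h * (z j / (Q j)%:R))) =
    (a - (h * spread t + n%:R * (h * (z j / (Q j)%:R)))) + h * S.
  by rewrite /a; ring.
by rewrite rpredD.
Qed.

Lemma measurable_phase (h : R) : measurable_fun setT (fun t => h * spread t).
Proof.
by apply: measurable_funM => //; apply: nondecreasing_measurable => //; exact: spread_homo.
Qed.

(** The angle of [phase_shift] is not a full turn, and 1 / Q j divides the period,
so [Rintegral_rotation0] applies. *)
Lemma Rintegral_phase0 (h : R) (j : nat) : resonant h j ->
  h * z j \is a Num.int -> h * (z j / (Q j)%:R) \isn't a Num.int ->
  \int[lebesgue_measure]_(t in `[0, 1]) cosT (h * spread t) = 0.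
Proof.
move=> res hz hzQ.
have ph n t : exists2 y, y \is a Num.int & h * spread (t + n%:R / (Q j)%:R) =
    h * spread t + n%:R * (h * (z j / (Q j)%:R)) + y.
  exists (h * spread (t + n%:R / (Q j)%:R) -
    (h * spread t + n%:R * (h * (z j / (Q j)%:R)))); first exact: phase_shift.
  by rewrite subrKC.
have ph1 t : exists2 y, y \is a Num.int & h * spread (t + 1) = h * spread t + y.
  have [y yint] := ph (Q j) t; rewrite divff ?gt_eqF// => ->.
  exists ((Q j)%:R * (h * (z j / (Q j)%:R)) + y); last by rewrite addrA.
  rewrite rpredD// (_ : _ * _ = h * z j)//.
  by rewrite [h * (_ / _)]mulrA mulrC divfK// gt_eqF.
have phr t : exists2 y, y \is a Num.int & h * spread (t + (Q j)%:R^-1) =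
    h * spread t + h * (z j / (Q j)%:R) + y.
  by have [y yint] := ph 1%N t; rewrite !mul1r => ->; exists y.
apply: (@Rintegral_rotation0 _ _ (fun t => sinT (h * spread t)) (Q j)%:R^-1) hzQ _ _.
- by apply: measurable_cosT; exact: measurable_phase.
- by apply: measurable_sinT; exact: measurable_phase.
- by exists 1 => t; exact: cosT_norm_le1.
- by exists 1 => t; exact: sinT_norm_le1.
- by move=> t; have [y yint ->] := ph1 t; rewrite cosTDint.
- by move=> t; have [y yint ->] := ph1 t; rewrite sinTDint.
- by rewrite invr_ge0 ltW//= invf_le1// ler1n.
- by move=> t; have [y yint ->] := phr t; rewrite cosTDint// cosTD.
- by move=> t; have [y yint ->] := phr t; rewrite sinTDint// sinTD.
Qed.

(** Here the angle of [phase_shift] is a full turn, so t may be reduced to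
[0, 1 / Q j), where the first j + 1 blocks of digits vanish and [spread] is too
small to move the wave away from 1. *)
Lemma cosT_phase_ge (h : R) (j : nat) (t : R) : resonant h j -> 0 <= t ->
  h * (z j / (Q j)%:R) \is a Num.int -> `|h| * (z j.+1 / (Q j)%:R) <= 1 / 8 ->
  1 / 2 <= cosT (h * spread t).
Proof.
move=> res t0 hz h8.
have [n nE] : exists n : nat, Num.floor ((Q j)%:R * t) = n.
  have : 0 <= Num.floor ((Q j)%:R * t) by rewrite floor_ge0 mulr_ge0.
  by case: Num.floor => // n _; exists n.
pose r := t - n%:R / (Q j)%:R.
have r_itv : 0 <= r < (Q j)%:R^-1.
  have := gfloor_le j t; have := gfloor_gt j t.
  by rewrite /gfloor nE -pmulrn /r; move=> ? ?; apply/andP; split; lra.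
rewrite (_ : t = r + n%:R / (Q j)%:R); last by rewrite subrK.
set x := h * spread _.
have -> : x = h * spread r + (n%:R * (h * (z j / (Q j)%:R)) +
    (x - (h * spread r + n%:R * (h * (z j / (Q j)%:R))))) by ring.
rewrite cosTDint; last first.
  by rewrite rpredD ?phase_shift// rpredM// natr_int.
apply: cosT_ge_half; apply: le_trans h8.
have [/andP[r0 rj] small] : 0 <= r < (Q j)%:R^-1 /\
    forall i, (i < j.+1)%N -> gfloor i r = 0.
  by split=> // i ij; exact: gfloor_small r_itv.
have /andP[sp0 spr] := spread_le r0 small.
rewrite normrM ler_wpM2l// ger0_norm// (le_trans spr)//.
have z_ge0 i : 0 <= z i.
  have -> : 0 = limn z by apply/esym/cvg_lim.
  apply: nonincreasing_cvgn_ge; last by apply/cvg_ex; exists 0.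
  exact/nonincreasing_seqP.
by rewrite mulrC ler_wpM2l// ltW.
Qed.

End spread.

(** * Counting pairs near the edges of a square *)

Lemma sum_lt_le (R : realType) (N M : nat) :
  \sum_(m < N) ((m < M)%N%:R : R) <= M%:R.
Proof.
rewrite -natr_sum ler_nat; suff -> : (\sum_(m < N) (m < M) = minn N M)%N.
  exact: geq_minr.
elim: N => [|N IHN]; first by rewrite big_ord0 min0n.
by rewrite big_ord_recr/= IHN; case: ltnP => /=; lia.
Qed.

Lemma sum_ge_eq (R : realType) (N L : nat) :
  \sum_(m < N) ((L <= m)%N%:R : R) = (N - L)%:R.
Proof.
rewrite -natr_sum; congr _%:R.
elim: N => [|N IHN]; first by rewrite big_ord0 sub0n.
by rewrite big_ord_recr/= IHN; case: leqP => /=; lia.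
Qed.

Lemma sum_edge_le (R : realType) (N M : nat) :
  \sum_(m < N) \sum_(n < N) ((m < M)%N%:R + (n < M)%N%:R : R)
    <= 2 * M%:R * N%:R.
Proof.
have S_le := sum_lt_le R N M; set S := \sum_(m < N) _ in S_le.
have -> : \sum_(m < N) \sum_(n < N) ((m < M)%N%:R + (n < M)%N%:R : R) =
    S * N%:R + S * N%:R.
  under eq_bigr => m _ do rewrite big_split/= sumr_const card_ord.
  rewrite big_split/= sumrMnl sumr_const card_ord -/S.
  by rewrite -(mulr_natr S N).
by rewrite -mulrDl ler_wpM2r//; lra.
Qed.

(** * Digits with zero blocks of factorial lengths *)

Section blocks.
Context {R : realType}.
Variables a b p : nat.
Hypotheses (a_ge2 : (2 <= a)%N) (b_ge2 : (2 <= b)%N) (p_gt0 : (0 < p)%N).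
Let q := (a * b)%N.

(** The first i.+1 blocks contain p * i.+1`! digits of t, and i`! zeros are inserted
before the end of the last of them; factorials make each block much longer than
everything that precedes it. *)
Definition grid (i : nat) : nat := (q ^ (p * i.+1`!))%N.

Definition decay (i : nat) : R := q%:R ^- i`!.

Definition gapped : R -> R := spread grid decay.

Let q_gt1 : (1 < q)%N. Proof. by rewrite /q; nia. Qed.
Let qR_gt0 : 0 < q%:R :> R. Proof. by rewrite ltr0n; lia. Qed.
Let qR_ge1 : 1 <= q%:R :> R. Proof. by rewrite ler1n; lia. Qed.

Lemma grid_gt0 i : (0 < grid i)%N. Proof. by rewrite expn_gt0; lia. Qed.

Lemma grid_dvd i : (grid i %| grid i.+1)%N.
Proof. by rewrite dvdn_exp2l// leq_mul2l leq_fact ?orbT. Qed.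

Lemma decay_anti i : decay i.+1 <= decay i.
Proof. by rewrite lef_pV2 ?posrE ?exprn_gt0// ler_weXn2l// leq_fact. Qed.

Lemma decay_cvg0 : decay @ \oo --> (0 : R).
Proof.
apply: (@squeeze_cvgr _ _ _ _ (fun=> 0) harmonic); last 2 first.
- exact: cvg_cst.
- exact: cvg_harmonic.
near=> n; rewrite /decay /harmonic/= invr_ge0 exprn_ge0 ?(ltW qR_gt0)//=.
rewrite lef_pV2 ?posrE ?exprn_gt0// -natrX ler_nat.
by rewrite (leq_trans (ltn_expl n q_gt1))// leq_pexp2l ?fact_geq//; lia.
Unshelve. all: by end_near. Qed.

Let decay_grid i : decay i / (grid i)%:R = q%:R ^- (p * i.+1`! + i`!).
Proof. by rewrite /decay /grid natrX -invfM -exprD addnC. Qed.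

Let decayS_grid i : decay i.+1 / (grid i)%:R = q%:R ^- (p.+1 * i.+1`!).
Proof. by rewrite /decay /grid natrX -invfM -exprD mulSn addnC. Qed.

Lemma gapped_homo : {homo gapped : t u / t <= u}.
Proof. exact: (spread_homo grid_gt0 decay_anti decay_cvg0). Qed.

(** The values lie in an interval shorter than half a turn, on which the distance
of the circle is the distance of the line. *)
Lemma gapped_range t : 0 <= t <= 1 -> 0 <= gapped t <= 1 / 4.
Proof.
move=> /andP[t0 t1].
have /andP[g0 gt] : 0 <= gapped t <= t * decay 0.
  by apply: (spread_le grid_gt0 grid_dvd decay_anti decay_cvg0).
rewrite g0 (le_trans gt)// (@le_trans _ _ (decay 0)) ?ler_piMl//.
  by rewrite invr_ge0 exprn_ge0// ltW.
rewrite /decay expr1 mul1r lef_pV2 ?posrE// ler_nat /q; nia.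
Qed.

(** Let j.+1 be the first level i with 2 / grid i <= t - u; level 0 only costs a
constant. Then t - u < 2 / grid j, and
(grid j)^-1 is the p-th power of decay j.+1, so that the factor decay j.+1 lost
in [spread_gap] is at least ((t - u) / 2)^(1/p). *)
Lemma gapped_expand (s t u : R) : 0 <= s -> s * p.+1%:R <= p%:R ->
  0 <= u -> u < t -> t <= 1 ->
  t - u <= 2 * q%:R * (gapped t - gapped u) `^ s.
Proof.
move=> s0 sp u0 ut t1.
have t0 : 0 <= t by rewrite (le_trans u0)// ltW.
have u1 : u <= 1 by rewrite (le_trans _ t1)// ltW.
have /andP[gt0 gt4] : 0 <= gapped t <= 1 / 4 by apply: gapped_range; rewrite t0.
have /andP[gu0 gu4] : 0 <= gapped u <= 1 / 4 by apply: gapped_range; rewrite u0.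
set D := gapped t - gapped u.
have tu_gt0 : 0 < t - u by rewrite subr_gt0.
have gap j : 2 / (grid j)%:R <= t - u -> (t - u) / 2 * decay j <= D.
  exact: (spread_gap grid_gt0 grid_dvd decay_anti decay_cvg0).
have [j0 j0P] : exists j, 2 / (grid j)%:R <= t - u.
  pose j := Num.truncn (2 / (t - u)); exists j.
  rewrite ler_pdivrMr ?ltr0n ?grid_gt0// mulrC -ler_pdivrMr//.
  rewrite ltW// (lt_le_trans (truncnS_gt _))// ler_nat.
  apply: leq_trans (ltnW (ltn_expl j.+1 q_gt1)) _; rewrite /grid leq_pexp2l//.
    exact: ltnW q_gt1.
  by rewrite (leq_trans (fact_geq _))// leq_pmull.
have decay_gt0 j : 0 < decay j by rewrite invr_gt0 exprn_gt0.
have D_gt0 : 0 < D by apply: lt_le_trans (gap _ j0P); rewrite mulr_gt0// divr_gt0.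
have D_le1 : D <= 1 by rewrite /D; lra.
have s_le1 : s <= 1.
  have : s * p.+1%:R <= p.+1%:R by rewrite (le_trans sp)// ler_nat.
  by rewrite -[X in _ <= X]mul1r ler_pM2r// ltr0n.
have [[|j] jP jmin] := ex_minnP (ex_intro (fun j => 2 / (grid j)%:R <= t - u) j0 j0P).
  have := gap _ jP; rewrite /decay expr1 ler_pdivrMr//.
  have DD : D <= D `^ s by rewrite ger1_powR// D_gt0.
  have := ler_wpM2l (ltW qR_gt0) DD; rewrite -mulrA; move: (D `^ s) => E.
  by move=> ? ?; lra.
have tu_lt : (t - u) / 2 < (decay j.+1) ^+ p.
  have : ~~ (2 / (grid j)%:R <= t - u) by apply/negP => /jmin; rewrite ltnn.
  rewrite -ltNge /decay /grid -exprVn -exprM natrX mulnC -exprVn; lra.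
have D_pow : ((t - u) / 2) ^+ p.+1 <= D ^+ p.
  rewrite exprSr (le_trans (ler_wpM2l _ (ltW tu_lt))) ?exprn_ge0 ?divr_ge0 ?(ltW tu_gt0)//.
  rewrite -exprMn; apply: lerXn2r; last exact: gap.
    by rewrite nnegrE mulr_ge0 ?divr_ge0 ?(ltW tu_gt0) ?(ltW (decay_gt0 _)).
  by rewrite nnegrE ltW.
have half_le : (t - u) / 2 <= D `^ s.
  rewrite -(@ler_pXn2r _ p.+1) ?nnegrE ?divr_ge0 ?powR_ge0 ?(ltW tu_gt0)//.
  rewrite (le_trans D_pow)// -!powR_mulrn ?powR_ge0 ?(ltW D_gt0)// -powRrM.
  by apply: ger_powR; rewrite ?D_gt0.
have : (t - u) / 2 <= q%:R * D `^ s.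
  by rewrite (le_trans half_le)// ler_peMl ?powR_ge0.
by rewrite -mulrA => ?; lra.
Qed.

(** * The Fourier coefficients of the law of the gapped digits *)

Variable k : int.
Hypothesis k_neq0 : k != 0.

Definition freq (m n : nat) : R := k%:~R * a%:R ^+ m * b%:R ^+ n.

Lemma dvd_pow_le (h : R) (e e' : nat) : (e <= e')%N ->
  h * q%:R ^- e' \is a Num.int -> h * q%:R ^- e \is a Num.int.
Proof.
move=> ee' hint.
have -> : h * q%:R ^- e = h * q%:R ^- e' * q%:R ^+ (e' - e).
  rewrite -{1}(subnK ee') exprD; field.
  by rewrite !expf_neq0// gt_eqF.
by rewrite rpredM// rpredX// natr_int.
Qed.

Lemma freq_dvd (e m n : nat) : (e <= m)%N -> (e <= n)%N ->
  freq m n * q%:R ^- e \is a Num.int.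
Proof.
move=> em en.
have -> : freq m n * q%:R ^- e = k%:~R * a%:R ^+ (m - e) * b%:R ^+ (n - e).
  rewrite /freq -{1}(subnK em) -{1}(subnK en) !exprD /q natrM exprMn; field.
  by rewrite !expf_neq0// pnatr_eq0; lia.
by rewrite !rpredM ?rpredX ?natr_int ?intr_int.
Qed.

(* The margin by which m and n stay below the exponent of the power of q that they
   are compared with, so that the powers of a and b left over exceed 8 |k|. *)
Let c := (`|k| + 3)%N.

(** Otherwise a^(e - m) b^(e - n) would divide k, while it exceeds 2^|k|. *)
Lemma freq_ndvd (e m n : nat) : (m + c <= e)%N -> (n + c <= e)%N ->
  freq m n * q%:R ^- e \isn't a Num.int.
Proof.
move=> me ne; apply/negP => /intrP[w wE].
have a_neq0 : a%:R != 0 :> R by rewrite pnatr_eq0; lia.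
have b_neq0 : b%:R != 0 :> R by rewrite pnatr_eq0; lia.
have kE : k = w * (a ^ (e - m) * b ^ (e - n))%N.
  apply/eqP; rewrite -(eqr_int R) rmorphM /= -pmulrn natrM !natrX -wE.
  have qE : q%:R ^+ e =
      (a%:R ^+ (e - m) * b%:R ^+ (e - n)) * (a%:R ^+ m * b%:R ^+ n) :> R.
    by rewrite mulrACA -!exprD !subnK ?natrM ?exprMn//; lia.
  rewrite /freq qE; apply/eqP; field.
  by rewrite !expf_neq0.
have w_gt0 : (0 < `|w|)%N.
  by rewrite absz_gt0; apply: contra_neq k_neq0 => w0; rewrite kE w0 mul0r.
have : (2 ^ c <= `|k|)%N.
  rewrite kE abszM absz_nat (leq_trans _ (leq_pmull _ w_gt0))//.
  rewrite -[leqLHS]muln1 leq_mul ?expn_gt0//; last by lia.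
  by rewrite (leq_trans (leq_pexp2l _ (_ : c <= e - m)%N)) ?leq_exp2r//; lia.
by rewrite /c; have := ltn_expl (`|k| + 3) (ltnSn 1); lia.
Qed.

Lemma freq_small (e m n : nat) : (m + c <= e)%N -> (n + c <= e)%N ->
  `|freq m n| * q%:R ^- e <= 1 / 8.
Proof.
move=> me ne.
have k_le : (8 * `|k| <= a ^ c * b ^ c)%N.
  rewrite (@leq_trans (2 ^ c))//.
    by rewrite /c expnD; have := ltn_expl `|k| (ltnSn 1); lia.
  rewrite -[leqLHS]muln1 leq_mul ?leq_exp2r//; first by rewrite /c; lia.
  by rewrite expn_gt0; lia.
have small : (8 * `|k| * (a ^ m * b ^ n) <= q ^ e)%N.
  rewrite (leq_trans (leq_mul k_le (leqnn _)))// mulnACA -!expnD /q expnMn.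
  by rewrite leq_mul// leq_pexp2l//; lia.
rewrite ler_pdivrMr ?exprn_gt0// /freq !normrM !normrX !normr_nat.
have -> : `|k%:~R| = `|k|%N%:R :> R by rewrite -intr_norm -abszE pmulrn.
have : (8 * `|k| * (a ^ m * b ^ n))%:R <= (q ^ e)%:R :> R by rewrite ler_nat.
by rewrite /q !(natrM, natrX); lra.
Qed.

(** The real part of a Fourier coefficient of the law of [gapped t]. *)
Definition mean (m n : nat) : R :=
  \int[lebesgue_measure]_(t in `[0, 1]) cosT (freq m n * gapped t).

Lemma measurable_wave h : measurable_fun setT (fun t => cosT (h * gapped t)).
Proof.
apply: measurable_cosT; apply: measurable_phase.
- exact: grid_gt0.
- exact: decay_anti.
- exact: decay_cvg0.
Qed.

Lemma integrable_wave h :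
  lebesgue_measure.-integrable `[0, 1] (EFin \o (fun t => cosT (h * gapped t))).
Proof.
apply: bounded_integrable_itv; first exact: measurable_wave.
by exists 1 => t; exact: cosT_norm_le1.
Qed.

Lemma Rintegral_unit_itv_cst (x : R) :
  \int[lebesgue_measure]_(t in `[0, 1]) x = x.
Proof.
rewrite Rintegral_cst//= lebesgue_measure_itv/= lte_fin ltr01.
by rewrite oppr0 adde0 mulr1.
Qed.

Lemma mean_norm_le1 m n : `|mean m n| <= 1.
Proof.
have le1 t := cosT_norm_le1 (freq m n * gapped t).
rewrite ler_norml -{1}(Rintegral_unit_itv_cst (-1)).
rewrite -{3}(Rintegral_unit_itv_cst 1); apply/andP; split.
  apply: le_Rintegral => //; last by move=> t _; have := le1 t; rewrite ler_norml => /andP[].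
    by apply: bounded_integrable_itv => //; exists 1 => _; rewrite normrN1.
  exact: integrable_wave.
apply: le_Rintegral => //; last by move=> t _; have := le1 t; rewrite ler_norml => /andP[].
  exact: integrable_wave.
by apply: bounded_integrable_itv => //; exists 1 => _; rewrite normr1.
Qed.

(* M and M' are the ends of two consecutive zero blocks, and L is the end of the
   digits between them. *)
Section level.
Variable J : nat.
Let M := (p.+1 * J.+1`!)%N.
Let L := (p * J.+2`! + J.+1`!)%N.
Let M' := (p.+1 * J.+2`!)%N.

Let resonant_freq m n : (M <= m)%N -> (M <= n)%N ->
  resonant grid decay (freq m n) J.+1.
Proof.
move=> Mm Mn i iJ; rewrite decay_grid decayS_grid.
have iJf : (i.+1`! <= J.+1`!)%N by rewrite leq_fact.
have iif : (i`! <= i.+1`!)%N by rewrite leq_fact.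
split; apply: dvd_pow_le (freq_dvd Mm Mn); rewrite /M.
  rewrite mulSn [leqRHS]addnC; apply: leq_add; last exact: leq_trans iif iJf.
  by rewrite leq_mul.
by rewrite leq_mul.
Qed.

Let ML : (M <= L)%N.
Proof. by rewrite /M /L mulSn addnC leq_add// leq_mul2l leq_fact ?orbT. Qed.

Lemma mean_eq0 m n : (M <= m)%N -> (M <= n)%N ->
  freq m n * q%:R ^- L \isn't a Num.int -> mean m n = 0.
Proof.
move=> Mm Mn ndvd.
apply: (@Rintegral_phase0 _ _ _ grid_gt0 grid_dvd decay_anti decay_cvg0 _ J.+1).
- exact: resonant_freq.
- by apply: dvd_pow_le (freq_dvd Mm Mn); rewrite /M leq_pmull.
- by rewrite decay_grid.
Qed.

Lemma mean_ge_half m n : (M <= m)%N -> (M <= n)%N ->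
  (m + c <= M')%N -> (n + c <= M')%N ->
  freq m n * q%:R ^- L \is a Num.int -> 1 / 2 <= mean m n.
Proof.
move=> Mm Mn mM' nM' dvd; rewrite -(Rintegral_unit_itv_cst (1 / 2)).
apply: le_Rintegral => //; last 2 first.
- exact: integrable_wave.
- move=> t /=; rewrite in_itv/= => /andP[t0 _].
  apply: (@cosT_phase_ge _ _ _ grid_gt0 grid_dvd decay_anti decay_cvg0 _ J.+1) => //.
  + exact: resonant_freq.
  + by rewrite decay_grid.
  + by rewrite decayS_grid freq_small.
by apply: bounded_integrable_itv => //; exists `|1 / 2|.
Qed.

Lemma sum_mean_le N : (N + c <= L)%N ->
  \sum_(m < N) \sum_(n < N) mean m n <= 2 * M%:R * N%:R.
Proof.
move=> NL.
apply: le_trans (sum_edge_le R N M).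
apply: ler_sum => m _; apply: ler_sum => n _.
have := mean_norm_le1 m n; rewrite ler_norml => /andP[_ mean1].
have [mM|Mm] := ltnP m M; first by rewrite (le_trans mean1)// lerDl ler0n.
have [nM|Mn] := ltnP n M; first by rewrite add0r.
by rewrite mean_eq0 ?addr0// freq_ndvd// (leq_trans _ NL)// leq_add2r ltnW.
Qed.

Lemma sum_mean_ge N : (L <= N)%N -> (N + c <= M')%N ->
  1 / 2 * (N - L)%:R ^+ 2 - 2 * M%:R * N%:R <=
  \sum_(m < N) \sum_(n < N) mean m n.
Proof.
move=> LN NM'.
apply: (@le_trans _ _ (\sum_(m < N) \sum_(n < N)
    (1 / 2 * ((L <= m)%N%:R * (L <= n)%N%:R) - ((m < M)%N%:R + (n < M)%N%:R) : R))).
  under eq_bigr do rewrite sumrB.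
  rewrite sumrB lerB//.
    under eq_bigr do rewrite -mulr_sumr -mulr_sumr.
    rewrite -mulr_sumr ler_wpM2l//.
    by rewrite -mulr_suml sum_ge_eq expr2.
  exact: sum_edge_le.
apply: ler_sum => m _; apply: ler_sum => n _.
have := mean_norm_le1 m n; rewrite ler_norml => /andP[mean1 _].
have [mM|Mm] := ltnP m M.
  rewrite leqNgt (leq_trans mM ML)/= mul0r mulr0 sub0r (le_trans _ mean1)//.
  by rewrite lerN2 lerDl ler0n.
have [nM|Mn] := ltnP n M.
  rewrite [(L <= n)%N]leqNgt (leq_trans nM ML)/= !mulr0 sub0r (le_trans _ mean1)//.
  by rewrite add0r.
rewrite addr0 subr0.
have mcM' : (m + c <= M')%N by rewrite (leq_trans _ NM')// leq_add2r ltnW.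
have ncM' : (n + c <= M')%N by rewrite (leq_trans _ NM')// leq_add2r ltnW.
have [dvd|ndvd] := boolP (freq m n * q%:R ^- L \is a Num.int).
  rewrite (le_trans _ (mean_ge_half Mm Mn mcM' ncM' dvd))//.
  by rewrite -natrM mulnb; case: (_ && _) => /=; lra.
rewrite (mean_eq0 Mm Mn ndvd).
rewrite -natrM mulnb; have [/andP[Lm Ln]|_] := boolP (_ && _); last by rewrite mulr0.
by rewrite freq_dvd in ndvd.
Qed.

(** * Oscillation of the means *)

Definition mean_avg (N : nat) : R :=
  (N%:R ^+ 2)^-1 * \sum_(m < N) \sum_(n < N) mean m n.

(** Up to N = L - c only the edges m < M and n < M contribute, a proportion of
O(p / J). Up to N = M' - c the corner L <= m, n < N, of proportion at least
1 / (2 (p+1))^2, adds a positive amount. *)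
Lemma mean_avg_gap : (c <= J)%N -> (64 * p.+1 ^ 3 <= J)%N ->
  (16 * p.+1%:R ^+ 2)^-1 <= mean_avg (M' - c) - mean_avg (L - c).
Proof.
move=> cJ pJ; set N1 := (L - c)%N; set N2 := (M' - c)%N.
set P : R := p.+1%:R; set X : R := J.+2%:R.
have JF : (J.+1 <= J.+1`!)%N := fact_geq _.
have cF : (c <= J.+1`!)%N by rewrite (leq_trans cJ)// ltnW.
have GE : (J.+2`! = J.+2 * J.+1`!)%N by rewrite factS.
have [N1G N2G NL NcL] : [/\ (J.+2`! <= N1)%N, (J.+2`! <= N2)%N,
    (J.+2`! <= 2 * (N2 - L))%N & (L <= N2)%N].
  rewrite /N1 /N2 /L /M'; move: (J.+1`!) (J.+2`!) JF GE p_gt0 pJ cJ => F G.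
  by clear; split; nia.
have P_gt0 : 0 < P by rewrite ltr0n.
have X_gt0 : 0 < X by rewrite ltr0n.
have G_gt0 : 0 < (J.+2`!)%:R :> R by rewrite ltr0n fact_gt0.
have N1_gt0 : 0 < N1%:R :> R by apply: lt_le_trans G_gt0 _; rewrite ler_nat.
have N2_gt0 : 0 < N2%:R :> R by apply: lt_le_trans G_gt0 _; rewrite ler_nat.
have edge N : (J.+2`! <= N)%N -> 0 < N%:R :> R -> 2 * M%:R / N%:R <= 2 * P / X.
  move=> GN N_gt0; rewrite ler_pdivrMr// mulrAC ler_pdivlMr// -!mulrA.
  rewrite ler_wpM2l// /P /X -!natrM ler_nat /M -mulnA leq_mul//.
  by rewrite mulnC -GE.
have corner : 1 / (2 * P) <= (N2 - L)%:R / N2%:R.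
  rewrite ler_pdivlMr// mulrAC mul1r ler_pdivrMr ?mulr_gt0//.
  rewrite /P -!natrM ler_nat (@leq_trans (p.+1 * J.+2`!))//.
    by rewrite /N2 /M' leq_subr.
  by move: NL; nia.
have PX : 4 * P / X <= (16 * P ^+ 2)^-1.
  rewrite ler_pdivrMr// -[leRHS]mulrC ler_pdivlMr ?mulr_gt0 ?exprn_gt0//.
  have : (64 * p.+1 ^ 3)%:R <= X by rewrite ler_nat; lia.
  by rewrite natrM natrX -/P; nra.
have avg1 : mean_avg N1 <= 2 * P / X.
  apply: le_trans (edge _ N1G N1_gt0); rewrite /mean_avg ler_pdivrMl ?exprn_gt0//.
  have -> : N1%:R ^+ 2 * (2 * M%:R / N1%:R) = 2 * M%:R * N1%:R :> R.
    by field; rewrite gt_eqF.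
  by apply: sum_mean_le; rewrite /N1 subnK// (leq_trans cF)// leq_addl.
have avg2 : 1 / 2 * (1 / (2 * P)) ^+ 2 - 2 * P / X <= mean_avg N2.
  apply: (@le_trans _ _ (1 / 2 * ((N2 - L)%:R / N2%:R) ^+ 2 - 2 * M%:R / N2%:R)).
    by rewrite lerB ?edge// ler_wpM2l// ler_pXn2r// nnegrE ?divr_ge0 ?mulr_ge0// ltW.
  rewrite /mean_avg ler_pdivlMl ?exprn_gt0//.
  have -> : N2%:R ^+ 2 *
      (1 / 2 * ((N2 - L)%:R / N2%:R) ^+ 2 - 2 * M%:R / N2%:R) =
      1 / 2 * (N2 - L)%:R ^+ 2 - 2 * M%:R * N2%:R :> R.
    by field; rewrite gt_eqF.
  by apply: sum_mean_ge => //; rewrite /N2 subnK// (leq_trans cF)// (leq_trans _ (leq_pmull _ _)) ?leq_fact.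
(* What follows gives the difference a lower bound of 2 D - 2 B, with 2 B <= D. *)
have AD : 1 / 2 * (1 / (2 * P)) ^+ 2 = 2 * (16 * P ^+ 2)^-1.
  by field; rewrite gt_eqF.
have BB : 4 * P / X = 2 * (2 * P / X) by ring.
rewrite AD in avg2; rewrite BB in PX; move: avg1 avg2 PX.
set D := (16 * P ^+ 2)^-1; set B := 2 * P / X.
by move: D B (mean_avg N1) (mean_avg N2) => D B s1 s2; lra.
Qed.

End level.

Definition wave_avg (N : nat) (t : R) : R :=
  (N%:R ^+ 2)^-1 * \sum_(m < N) \sum_(n < N) cosT (freq m n * gapped t).

Lemma wave_avg_norm_le1 N t : `|wave_avg N t| <= 1.
Proof.
rewrite normrM ger0_norm ?invr_ge0 ?exprn_ge0//.
case: N => [|N]; first by rewrite big_ord0 normr0 mulr0.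
rewrite ler_pdivrMl ?exprn_gt0// mulr1 (le_trans (ler_norm_sum _ _ _))//.
apply: (@le_trans _ _ (\sum_(m < N.+1) N.+1%:R)); last first.
  by rewrite sumr_const card_ord -(mulr_natr N.+1%:R) expr2.
apply: ler_sum => m _; rewrite (le_trans (ler_norm_sum _ _ _))//.
apply: (@le_trans _ _ (\sum_(n < N.+1) 1)); last first.
  by rewrite sumr_const card_ord.
by apply: ler_sum => n _; exact: cosT_norm_le1.
Qed.

Lemma measurable_wave_avg N : measurable_fun setT (wave_avg N).
Proof.
apply: measurable_funM => //.
apply: measurable_sum => m; apply: measurable_sum => n.
exact: measurable_wave.
Qed.

Lemma integrable_wave_avg N :
  lebesgue_measure.-integrable `[0, 1] (EFin \o wave_avg N).
Proof.
apply: bounded_integrable_itv; first exact: measurable_wave_avg.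
by exists 1 => t; exact: wave_avg_norm_le1.
Qed.

Lemma Rintegral_wave_avg N :
  \int[lebesgue_measure]_(t in `[0, 1]) wave_avg N t = mean_avg N.
Proof.
have int2 m : lebesgue_measure.-integrable `[0, 1] (EFin \o (fun t =>
    \sum_(n < N) cosT (freq m n * gapped t))).
  by apply: integrable_sum_EFin => // n; exact: integrable_wave.
rewrite RintegralZl//; last by apply: integrable_sum_EFin => // m; exact: int2.
rewrite Rintegral_sum//; congr (_ * _); apply: eq_bigr => m _.
by rewrite Rintegral_sum// => n; exact: integrable_wave.
Qed.

Let low j := (p * j.+2`! + j.+1`! - c)%N.
Let high j := (p.+1 * j.+2`! - c)%N.

Let cvg_low : low @ \oo --> \oo.
Proof.
move=> A [n _ nA]; exists (n + c)%N => // j /= ncj; apply: nA => /=.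
have JF : (j.+1 <= j.+1`!)%N := fact_geq _.
by rewrite /low; lia.
Qed.

Let cvg_high : high @ \oo --> \oo.
Proof.
move=> A [n _ nA]; exists (n + c)%N => // j /= ncj; apply: nA => /=.
have JF : (j.+2 <= j.+2`!)%N := fact_geq _.
by rewrite /high; nia.
Qed.

(** If the averages converged almost everywhere, the difference of the averages at
the two scales of [mean_avg_gap] would tend to 0 almost everywhere, and so would
its integral by dominated convergence. *)
Lemma divergence_not_negligible (D : set R) :
  (forall t, 0 <= t <= 1 -> ~ D t -> cvgn (wave_avg ^~ t)) ->
  ~ lebesgue_measure.-negligible D.
Proof.
move=> cvgD negD.
pose f j t := wave_avg (high j) t - wave_avg (low j) t.
have f_int j : \int[lebesgue_measure]_(t in `[0, 1]) f j t =
    mean_avg (high j) - mean_avg (low j).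
  by rewrite RintegralB ?Rintegral_wave_avg//; exact: integrable_wave_avg.
pose I : set R := `[0, 1]%classic.
have mf j : measurable_fun I (EFin \o f j).
  apply/measurable_EFinP; apply: measurable_funTS.
  by apply: measurable_funB; exact: measurable_wave_avg.
have f_cvg0 : {ae lebesgue_measure, forall t, I t ->
    (EFin \o f j) t @[j --> \oo] --> (cst 0%E : R -> \bar R) t}.
  apply: negligibleS negD => t /= /not_implyP[t01 tN]; apply: contrapT => Dt.
  apply: tN; rewrite /I/= in_itv/= in t01; have := cvgD t t01 Dt.
  move=> /cvg_ex[l tl]; apply/fine_cvgP; split; first exact: nearW.
  rewrite -(subrr l); apply: cvgB.
  + exact: (cvg_comp high (wave_avg ^~ t) cvg_high tl).
  + exact: (cvg_comp low (wave_avg ^~ t) cvg_low tl).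
have int2 : lebesgue_measure.-integrable I (EFin \o (cst 2 : R -> R)).
  by apply: bounded_integrable_itv => //; exists `|2|.
have f_le2 : {ae lebesgue_measure, forall t (j : nat), I t ->
    (`|(EFin \o f j) t| <= (EFin \o (cst 2%R : R -> R)) t)%E}.
  apply: aeW => t j _ /=; rewrite lee_fin (le_trans (ler_normB _ _))//.
  by rewrite -[leRHS]/(1 + 1) lerD// wave_avg_norm_le1.
have mI : measurable I by exact: measurable_itv.
have m0 : measurable_fun I (cst 0%E : R -> \bar R) by exact: measurable_cst.
have [_ _ f_lim] := @dominated_convergence _ _ _ lebesgue_measure I mI
  _ _ _ mf m0 f_cvg0 int2 f_le2.
rewrite integral_cst//= mul0e in f_lim.
have /fine_cvgP[_ lim0] := f_lim.
have P_gt0 : 0 < (16 * p.+1%:R ^+ 2)^-1 :> R.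
  by rewrite invr_gt0 mulr_gt0// exprn_gt0.
suff : (16 * p.+1%:R ^+ 2)^-1 <= 0 :> R by rewrite leNgt P_gt0.
apply: (cvgr_to_ge lim0).
exists (c + 64 * p.+1 ^ 3)%N => // j /= cpj.
have -> : fine (\int[lebesgue_measure]_(x in I) (f j x)%:E) =
    mean_avg (high j) - mean_avg (low j) by rewrite -f_int.
by apply: mean_avg_gap; lia.
Qed.

End blocks.

(** * Hausdorff measure and Lebesgue null sets *)

Section small_measure.
Context {R : realType}.
Local Notation mu := (@lebesgue_measure R).
Local Open Scope ereal_scope.

Lemma negligible_of_small (A : set R) :
  (forall e : R, (0 < e)%R ->
    exists B : set R, [/\ measurable B, A `<=` B & mu B <= e%:E]) ->
  mu.-negligible A.
Proof.
move=> small.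
have inv_gt0 (n : nat) : (0 < n.+1%:R^-1 :> R)%R by rewrite invr_gt0.
have [B BP] := choice (fun n : nat => small _ (inv_gt0 n)).
have mB : measurable (\bigcap_n B n).
  by apply: bigcapT_measurable => n; case: (BP n).
exists (\bigcap_n B n); split=> //; last first.
  by move=> t At n _; case: (BP n) => _ + _; exact.
apply/eqP; rewrite eq_le measure_ge0 andbT; apply/lee_addgt0Pr => e e0.
rewrite add0e.
pose n := Num.truncn e^-1.
case: (BP n) => mBn _ Bn; apply: le_trans (le_trans _ Bn) _.
  by apply: le_measure; rewrite ?inE//; exact: bigcap_inf.
rewrite lee_fin invf_ple ?posrE// ltW//; exact: truncnS_gt.
Qed.

(** The part of A that Phi maps into a set of diameter D lies in an interval of
length 2 C D^s, so a cover of E of small s-dimensional size pulls back to a cover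
of small Lebesgue measure. *)
Lemma hausdorff_null_preimage (M : metricType R) (Phi : R -> M) (s C : R)
    (A : set R) (E : set M) : (0 <= s)%R -> (0 <= C)%R ->
  (forall t u, A t -> A u ->
    (`|t - u| <= C * (mdist (Phi t) (Phi u)) `^ s)%R) ->
  hausdorff_measure s E = 0 -> mu.-negligible (A `&` Phi @^-1` E).
Proof.
move=> s0 C0 holder E0; apply: negligible_of_small => e e0.
(* The extra 1 keeps the denominator positive when C = 0. *)
pose e' := (e / (2 * C + 1))%R.
have C1 : (0 < 2 * C + 1)%R by rewrite ltr_wpDl// mulr_ge0.
have e'0 : (0 < e')%R by rewrite divr_gt0.
have : hausdorff_premeasure s 1 E < e'%:E.
  rewrite (@le_lt_trans _ _ 0) ?lte_fin// -E0; apply: ereal_sup_ubound.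
  by exists 1%R => /=.
move=> /ereal_inf_lt[_ [F [EF dF] <-]] Fe'.
have cover i : exists B : set R, [/\ measurable B,
    A `&` Phi @^-1` (F i) `<=` B & mu B <= (2 * C)%:E * diameter_pow s (F i)].
  have [[t0 [At0 Ft0]]|none] := pselect (A `&` Phi @^-1` (F i) !=set0); last first.
    exists set0; split => //; first by move=> t Gt; apply: none; exists t.
    rewrite measure0 mule_ge0 ?lee_fin ?mulr_ge0//.
    by rewrite /diameter_pow; case: ifP => // _; exact: poweR_ge0.
  have dist_le x y : F i x -> F i y -> (mdist x y)%:E <= diameter (F i).
    by move=> Fx Fy; apply: ereal_sup_ubound; exists (x, y).
  have [D diamE] : exists D : R, diameter (F i) = D%:E.
    have := dist_le _ _ Ft0 Ft0; have := dF i; case: diameter => // D _ _.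
    by exists D.
  have FN0 : F i == set0 = false.
    by apply/negbTE/set0P; exists (Phi t0).
  have D0 : (0 <= D)%R.
    by have := dist_le _ _ Ft0 Ft0; rewrite diamE lee_fin mdistxx.
  pose r := (C * D `^ s)%R.
  exists `[(t0 - r)%R, (t0 + r)%R]%classic; split.
  - exact: measurable_itv.
  - move=> t [At Ft] /=; rewrite in_itv/=.
    have : (`|t - t0| <= r)%R.
      rewrite (le_trans (holder _ _ At At0))// ler_wpM2l//.
      rewrite ge0_ler_powR// ?nnegrE// ?mdist_ge0//.
      by have := dist_le _ _ Ft Ft0; rewrite diamE lee_fin.
    by rewrite ler_norml => /andP[? ?]; apply/andP; split; lra.
  - rewrite lebesgue_measure_itv/= /diameter_pow FN0 diamE poweR_EFin -EFinM.
    case: ifP => _; last by rewrite lee_fin !mulr_ge0// powR_ge0.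
    by rewrite -EFinB lee_fin /r; lra.
have [B BP] := choice cover.
exists (\bigcup_i B i); split.
- by apply: bigcupT_measurable => i; case: (BP i).
- move=> t [At Et]; have [i _ Fi] := EF _ Et.
  by exists i => //; case: (BP i) => _ + _; apply; split.
apply: (@le_trans _ _ (\sum_(i <oo) (2 * C)%:E * diameter_pow s (F i))).
  apply: (@le_trans _ _ (\sum_(i <oo) mu (B i))).
    apply: measure_sigma_subadditive => //.
    + by move=> i; case: (BP i).
    + by apply: bigcupT_measurable => i; case: (BP i).
  by apply: lee_nneseries => // i _; case: (BP i).
rewrite nneseriesZl; last first.
  by move=> i _; rewrite /diameter_pow; case: ifP => // _; exact: poweR_ge0.
apply: (@le_trans _ _ ((2 * C)%:E * e'%:E)).
  by rewrite lee_wpmul2l ?lee_fin ?mulr_ge0// ltW.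
rewrite -EFinM lee_fin /e' mulrA ler_pdivrMr// mulrC ler_wpM2l ?(ltW e0)//.
by rewrite lerDl.
Qed.

End small_measure.

(** * The dimension of subsets of the circle is at most 1 *)

Section torus_dimension.
Context {R : realType}.
Local Open Scope quotient_scope.
Implicit Types (x y : R).

Let pi_lb (w : torus R) :
  lbound [set `|t| | t in [set t : R | \pi_(torus R) t = w]] (0 : R).
Proof. by move=> _ [t _ <-]. Qed.

Lemma mdist_pi_le x y :
  mdist (\pi_(torus R) x) (\pi_(torus R) y) <= `|x - y|.
Proof.
apply: ge_inf; first by exists 0; exact: pi_lb.
by exists (x - y) => //=; rewrite torus_piD torus_piN.
Qed.

(** Any other representative of x - y differs from it by at least 1. *)
Lemma mdist_pi_ge x y : `|x - y| <= 1 / 2 ->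
  `|x - y| <= mdist (\pi_(torus R) x) (\pi_(torus R) y).
Proof.
move=> xy; apply: lb_le_inf.
  by exists `|x - y|, (x - y) => //=; rewrite torus_piD torus_piN.
move=> _ [t /= tE <-].
have /torus_pi_eq/intrP[n nE] : \pi_(torus R) t = \pi_(torus R) (x - y).
  by rewrite tE torus_piD torus_piN.
have [n0|n0] := eqVneq n 0; first by move: nE; rewrite n0 => /subr0_eq ->.
have n1 : 1 <= `|n%:~R| :> R.
  by rewrite -intr_norm -[leLHS](mulr1z 1) ler_int; lia.
have : `|n%:~R| <= `|t| + `|x - y| by rewrite -nE ler_normB.
by lra.
Qed.

Lemma hausdorff_measure_ge0 (M : metricType R) (s : R) (E : set M) :
  (0 <= hausdorff_measure s E)%E.
Proof.
apply: (@le_trans _ _ (hausdorff_premeasure s 1 E)).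
  apply: le_ereal_inf_tmp => _ [F _ <-]; apply: nneseries_ge0 => i _ _.
  by rewrite /diameter_pow; case: ifP => // _; exact: poweR_ge0.
by apply: ereal_sup_ubound; exists 1 => /=.
Qed.

(** For n arcs of length v = 1 / n the sum is n v^s = v^(s - 1). *)
Lemma hausdorff_measure_torus (s : R) (E : set (torus R)) :
  1 < s -> hausdorff_measure s E = 0%E.
Proof.
move=> s1; apply/eqP; rewrite eq_le hausdorff_measure_ge0 andbT.
apply: ge_ereal_sup => _ [d /= d0 <-]; apply/lee_addgt0Pr => e e0.
rewrite add0e.
have s1_gt0 : 0 < s - 1 by rewrite subr_gt0.
(* Arcs shorter than the second bound give a sum of at most e. *)
pose v0 := Num.min d (e `^ (s - 1)^-1).
have v0_gt0 : 0 < v0 by rewrite lt_min d0 powR_gt0.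
pose n := (Num.truncn v0^-1).+1; pose v : R := n%:R^-1.
have v_gt0 : 0 < v by rewrite invr_gt0 ltr0n.
have [vd ve] : v <= d /\ v <= e `^ (s - 1)^-1.
  have : v <= v0 by rewrite invf_ple ?posrE ?ltr0n// ltW// truncnS_gt.
  by rewrite le_min => /andP[].
pose F i : set (torus R) := if (i < n)%N then
  [set \pi_(torus R) t | t in `[i%:R * v, i.+1%:R * v]%classic] else set0.
have F_diam i : (diameter (F i) <= v%:E)%E.
  apply: ge_ereal_sup => _ [[w w1] [/= + +] <-] /=; rewrite /F.
  case: ifP => // _ [t + <-] [u + <-]; rewrite /= !in_itv/= => /andP[t1 t2] /andP[u1 u2].
  rewrite lee_fin (le_trans (mdist_pi_le _ _))// ler_norml.
  by move: t2 u2; rewrite -natr1 mulrDl mul1r => t2 u2; apply/andP; split; lra.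
have F_cover : E `<=` \bigcup_i F i.
  move=> w _; pose t := repr w - (Num.floor (repr w))%:~R.
  have tw : \pi_(torus R) t = w.
    rewrite -[RHS]reprK; apply/torus_pi_eq.
    by rewrite /t addrAC subrr add0r rpredN intr_int.
  have /andP[t0 t1] : 0 <= t < 1.
    have /andP[] := floor_itv (repr w); rewrite intrD => ? ?.
    by rewrite /t; apply/andP; split; lra.
  have tv : 0 <= t / v by rewrite divr_ge0// ltW.
  have /andP[i1 i2] := truncn_itv tv; set i := Num.truncn _ in i1 i2.
  exists i => //; rewrite /F ifT; last first.
    rewrite -(ltr_nat R) (le_lt_trans i1)// /v invrK.
    by rewrite -[ltRHS]mul1r ltr_pM2r// ltr0n.
  exists t => //=; rewrite in_itv/= -!ler_pdivlMr// i1/=.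
  by rewrite -ler_pdivrMr// ltW.
apply: (@le_trans _ _ (\sum_(i <oo) diameter_pow s (F i))%E).
  apply: ereal_inf_lbound; exists F => //; split=> // i.
  by rewrite (le_trans (F_diam i))// lee_fin.
have dp_ge0 i : (0 <= diameter_pow s (F i))%E.
  by rewrite /diameter_pow; case: ifP => // _; exact: poweR_ge0.
rewrite (nneseries_split 0 n)// add0n [X in (_ + X)%E]eseries0 ?adde0; last first.
  by move=> i ni _; rewrite /F ltnNge ni/= /diameter_pow eqxx.
have dp_le i : (diameter_pow s (F i) <= (v `^ s)%:E)%E.
  rewrite /diameter_pow; case: ifPn => [_|/set0P[w Fw]].
    by rewrite lee_fin powR_ge0.
  rewrite -poweR_EFin gt0_ler_poweR//; first by rewrite (le_trans ler01)// ltW.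
    rewrite in_itv/= leey andbT.
    apply: (@le_trans _ _ (mdist w w)%:E); first by rewrite mdistxx.
    by apply: ereal_sup_ubound; exists (w, w).
  by rewrite in_itv/= leey andbT lee_fin ltW.
apply: (@le_trans _ _ (\sum_(0 <= k < n) (v `^ s)%:E)%E).
  by apply: lee_sum => k _; exact: dp_le.
rewrite sumEFin lee_fin sumr_const_nat subn0 -mulr_natl.
have -> : v `^ s = v * v `^ (s - 1).
  rewrite -[X in X * _](@powRr1 _ v) ?(ltW v_gt0)// -powRD ?subrKC//.
  by rewrite (gt_eqF v_gt0) implybT.
rewrite mulrA mulfV ?mul1r ?pnatr_eq0//.
rewrite (@le_trans _ _ ((e `^ (s - 1)^-1) `^ (s - 1)))//.
  by rewrite ge0_ler_powR ?nnegrE ?powR_ge0// ltW.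
by rewrite -powRrM mulVf ?gt_eqF// powRr1 ?(ltW e0).
Qed.

Lemma hausdorff_dim_torus_le1 (E : set (torus R)) : (hausdorff_dim E <= 1)%E.
Proof.
apply/lee_addgt0Pr => e e0; apply: ereal_inf_lbound.
exists (1 + e) => //; split; first by rewrite addr_ge0// ltW.
by apply: hausdorff_measure_torus; rewrite ltrDl.
Qed.

End torus_dimension.

(** * Real parts of the averages, and the dimension of the divergence set *)

Section complex_link.
Context {R : realType}.
Local Open Scope quotient_scope.

Lemma times_map_iter (a n : nat) (y : R) :
  iter n (times_map a) (\pi_(torus R) y) = \pi_(torus R) (a%:R ^+ n * y).
Proof.
have pi_mulrn (m : nat) (x : R) : \pi_(torus R) x *+ m = \pi_(torus R) (m%:R * x).
  elim: m => [|m IHm]; first by rewrite mul0r mulr0n torus_pi0.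
  by rewrite mulrS IHm -torus_piD -nat1r mulrDl mul1r.
elim: n => [|n IHn]; first by rewrite mul1r.
by rewrite iterS IHn /times_map -pmulrn pi_mulrn mulrA -exprS.
Qed.

Let ReD (z w : R[i]) : complex.Re (z + w) = complex.Re z + complex.Re w.
Proof. by case: z => ? ?; case: w => ? ?. Qed.

Lemma Re_birkhoff_avg (a b : nat) (k : int) (y : R) (N : nat) :
  complex.Re (birkhoff_avg a b (fourier_e k) (\pi_(torus R) y) N) =
  (N%:R ^+ 2)^-1 * \sum_(m < N) \sum_(n < N) cosT (freq a b k m n * y).
Proof.
have ReZ (r : R) (z : R[i]) : complex.Re (r%:C%C * z) = r * complex.Re z.
  by case: z => x x' /=; rewrite mul0r subr0.
rewrite /birkhoff_avg.
have -> : (N%:R ^+ 2)^-1 = ((N%:R ^+ 2)^-1 : R)%:C%C.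
  by rewrite fmorphV rmorphXn rmorph_nat.
rewrite ReZ (big_morph _ ReD (erefl : complex.Re 0 = 0)).
congr (_ * _); apply: eq_bigr => m _.
rewrite (big_morph _ ReD (erefl : complex.Re 0 = 0)); apply: eq_bigr => n _.
rewrite !times_map_iter fourier_e_pi /expi /cosT /freq /=.
by congr cos; ring.
Qed.

Lemma cvg_Re (z : nat -> R[i]^o) : cvgn z -> cvgn (fun n => complex.Re (z n)).
Proof.
move=> /cvg_ex[l zl]; apply/cvg_ex; exists (complex.Re l).
apply/cvgrPdist_lt => e e0.
have eC0 : 0 < e%:C%C :> R[i] by rewrite ltcR.
move/cvgrPdist_lt : zl => /(_ _ eC0); apply: filterS => n.
move=> /(le_lt_trans (normc_ge_Re _)); rewrite ltcR; apply: le_lt_trans.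
by case: l => ? ?; case: (z n).
Qed.

End complex_link.

(** For s < 1, the choice of p with s <= p / (p+1) makes [gapped] expanding with
exponent s, and a vanishing s-dimensional measure would contradict
[divergence_not_negligible]. *)
Lemma divergence_set_dim_ge1 (R : realType) (a b : nat) (k : int) :
  (2 <= a)%N -> (2 <= b)%N -> k != 0 ->
  (1 <= hausdorff_dim (divergence_set a b (@fourier_e R k)))%E.
Proof.
move=> a2 b2 k0.
apply: le_ereal_inf_tmp => _ [s [s0 E0] <-]; rewrite lee_fin leNgt; apply/negP => s1.
pose p := (Num.truncn (s / (1 - s))).+1.
have p_gt0 : (0 < p)%N by [].
have sp : s * p.+1%:R <= p%:R.
  have : s / (1 - s) <= p%:R by rewrite ltW// truncnS_gt.
  by rewrite ler_pdivrMr ?subr_gt0// -natr1; lra.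
pose g := gapped (R := R) a b p.
pose Phi t : torus R := \pi_(torus R)%qT (g t).
pose I : set R := `[0, 1]%classic.
have C0 : 0 <= 2 * (a * b)%:R :> R by rewrite mulr_ge0.
have negl := hausdorff_null_preimage (Phi := Phi) (A := I) s0 C0 _ E0.
apply: (divergence_not_negligible a2 b2 p_gt0 k0 _ (negl _)).
  move=> t t01 tD.
  have cvgPhi : cvgn (birkhoff_avg a b (fourier_e k) (Phi t) : nat -> R[i]^o).
    by apply: contrapT => ncvg; apply: tD; split.
  rewrite (_ : wave_avg a b p k ^~ t =
    fun N => complex.Re (birkhoff_avg a b (fourier_e k) (Phi t) N)).
    exact: cvg_Re cvgPhi.
  by apply/funext => N; rewrite Re_birkhoff_avg.
have expand t u : 0 <= u <= 1 -> 0 <= t <= 1 -> u <= t ->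
    `|t - u| <= 2 * (a * b)%:R * mdist (Phi t) (Phi u) `^ s.
  move=> u01 t01; rewrite le_eqVlt => /predU1P[->|ut].
    by rewrite subrr normr0 !mulr_ge0 ?powR_ge0.
  have /andP[gt0 gt4] := gapped_range a2 b2 p_gt0 t01 : 0 <= g t <= 1 / 4.
  have /andP[gu0 gu4] := gapped_range a2 b2 p_gt0 u01 : 0 <= g u <= 1 / 4.
  case/andP: u01 => u0 _; case/andP: t01 => _ t1.
  rewrite ger0_norm ?subr_ge0 ?(ltW ut)//.
  apply: le_trans (gapped_expand a2 b2 p_gt0 s0 sp u0 ut t1) _.
  have gut : 0 <= g t - g u.
    by rewrite subr_ge0 /g gapped_homo// ltW.
  rewrite ler_wpM2l// ge0_ler_powR ?nnegrE ?mdist_ge0//.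
  rewrite -[leLHS]ger0_norm//; apply: mdist_pi_ge.
  by rewrite -/(g t) -/(g u) ler_norml; apply/andP; split; lra.
move=> t u; rewrite /I/= !in_itv/= => t01 u01.
have [ut|/ltW tu] := leP u t; first exact: expand.
by rewrite distrC [mdist _ _]torus_distC; exact: expand.
Qed.

Theorem corollary1p5 (R : realType) (a b : int) (ha : 2 <= a) (hb : 2 <= b)
    (k : int) (hk : k != 0) :
  hausdorff_dim (divergence_set a b (@fourier_e R k)) = 1%E.
Proof.
apply/eqP; rewrite eq_le hausdorff_dim_torus_le1/=.
by case: a b ha hb => [a|//] [b|//] ha hb; exact: divergence_set_dim_ge1.
Qed.
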